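(* Let $U$ be a supertropical semiring, $M:=eU$, $x\in\mathcal T(U)$ and $a:=ex$. Assume that for any $b,c,d\in\mathcal T(U)e:=\{ey\mid y\in\mathcal T(U)\}\subset M$, $$abd=acd\ \Rightarrow\ ab=ac .$$ Then $\mathrm{Is}(x)=\mathrm{Sis}(x)$.
   Context: A supertropical semiring is a commutative semiring $U$ such that $e:=1+1$ is idempotent ($e+e=e$) and, for all $a,b\in U$, $a+b\in\{a,b\}$ if $ea\ne eb$, and $a+b=ea$ if $ea=eb$. (Then $ea=0\Rightarrow a=0$.) $\mathcal T(U):=U\setminus eU$ is the set of tangible elements. An MFCE-relation on $U$ is an equivalence relation $E$ with $x\sim_Ey\Rightarrow xz\sim_Eyz$ for all $z\in U$, and $x\sim_Ey\Rightarrow ex=ey$. MFCE-relations form a complete lattice under inclusion, with joins $\bigvee$. For $x\in\mathcal T(U)$, $\mathrm S(x):=Ux\cap\mathcal T(U)$ (sons of $x$), and for $c\in M$, $\mathrm S_c(x):=\{z\in\mathrm S(x)\mid ez=c\}$. For $z\in\mathcal T(U)$, $\mathrm{Is}(z)$ is the finest MFCE-relation $E$ on $U$ such that $s\sim_Et$ for all $s,t\in\mathrm S_{ez}(z)$. For $x\in\mathcal T(U)$, $\mathrm{Sis}(x):=\bigvee_{z\in\mathrm S(x)}\mathrm{Is}(z)$. *)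

(* Defs.v *)
From Corelib Require Import Relation_Definitions.
From mathcomp Require Import all_boot all_algebra.

Set Implicit Arguments.
Unset Strict Implicit.
Unset Printing Implicit Defensive.

Import GRing.Theory.
Local Open Scope ring_scope.

(* Semirings are unital; the trivial semiring is allowed ([Pz]), but it has no
   tangible elements. *)

Definition ghost_unit (U : comPzSemiRingType) : U := 1 + 1.

Record supertropical (U : comPzSemiRingType) : Prop := Supertropical {
  ghost_unit_idem : ghost_unit U + ghost_unit U = ghost_unit U;
  add_ghost_neq : forall a b : U,
    ghost_unit U * a <> ghost_unit U * b -> a + b = a \/ a + b = b;
  add_ghost_eq : forall a b : U,
    ghost_unit U * a = ghost_unit U * b -> a + b = ghost_unit U * a }.

Definition ghost (U : comPzSemiRingType) (y : U) : Prop :=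
  exists u : U, y = ghost_unit U * u.

Definition tangible (U : comPzSemiRingType) (y : U) : Prop := ~ ghost y.

Definition ghost_of_tangible (U : comPzSemiRingType) (b : U) : Prop :=
  exists2 y : U, tangible y & b = ghost_unit U * y.

Record MFCE (U : comPzSemiRingType) (E : relation U) : Prop := MkMFCE {
  MFCE_equivalence : equivalence U E;
  MFCE_mul : forall x y z : U, E x y -> E (x * z) (y * z);
  MFCE_ghost : forall x y : U, E x y -> ghost_unit U * x = ghost_unit U * y }.

(* The intersection of all MFCE-relations satisfying [P]. It is the finest one
   whenever it satisfies [P] itself and some MFCE-relation does; see
   [Is_finest] and [MFCE_join_lub] for the uses below. *)
Definition finest_MFCE (U : comPzSemiRingType) (P : relation U -> Prop) :
    relation U :=
  fun u v => forall E : relation U, MFCE E -> P E -> E u v.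

Definition MFCE_join (U : comPzSemiRingType) (F : relation U -> Prop) :
    relation U :=
  finest_MFCE (fun E => forall E' : relation U, F E' -> inclusion U E' E).

Definition son (U : comPzSemiRingType) (x z : U) : Prop :=
  (exists u : U, z = u * x) /\ tangible z.

Definition son_over (U : comPzSemiRingType) (x c z : U) : Prop :=
  son x z /\ ghost_unit U * z = c.

Definition identifies_sons (U : comPzSemiRingType) (z : U) (E : relation U) :
    Prop :=
  forall s t : U,
    son_over z (ghost_unit U * z) s -> son_over z (ghost_unit U * z) t -> E s t.

Definition Is (U : comPzSemiRingType) (z : U) : relation U :=
  finest_MFCE (identifies_sons z).

Definition Sis (U : comPzSemiRingType) (x : U) : relation U :=
  MFCE_join (fun E => exists2 z : U, son x z & E = Is z).

Lemma MFCE_ghost_eq (U : comPzSemiRingType) :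
  MFCE (fun x y : U => ghost_unit U * x = ghost_unit U * y).
Proof.
split=> //; last by move=> x y z xy; rewrite !mulrA xy.
by split=> [x|x y z -> ->|x y ->].
Qed.

Lemma MFCE_finest (U : comPzSemiRingType) (P : relation U -> Prop) :
  P (fun x y : U => ghost_unit U * x = ghost_unit U * y) ->
  MFCE (finest_MFCE P).
Proof.
move=> Pe; split.
- split=> [x E [[r _ _] _ _] _|x y z xy yz E ME PE|x y xy E ME PE].
  + exact: r.
  + by case: (ME) => -[_ t _] _ _; apply: t (xy E ME PE) (yz E ME PE).
  + by case: (ME) => -[_ _ s] _ _; apply: s (xy E ME PE).
- by move=> x y z xy E ME PE; apply: (MFCE_mul ME); apply: xy.
- by move=> x y xy; exact: (xy _ (MFCE_ghost_eq U) Pe).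
Qed.

Lemma Is_finest (U : comPzSemiRingType) (z : U) :
  [/\ MFCE (Is z), identifies_sons z (Is z) &
      forall E, MFCE E -> identifies_sons z E -> inclusion U (Is z) E].
Proof.
split=> [|s t zs zt E _|E ME zE u v].
- by apply: MFCE_finest => s t [_ ->] [_ ->].
- by move=> zE; exact: zE.
- by move=> uv; exact: uv.
Qed.

Lemma MFCE_join_lub (U : comPzSemiRingType) (F : relation U -> Prop) :
  (forall E, F E -> MFCE E) ->
  [/\ MFCE (MFCE_join F),
      forall E, F E -> inclusion U E (MFCE_join F) &
      forall E, MFCE E -> (forall E', F E' -> inclusion U E' E) ->
        inclusion U (MFCE_join F) E].
Proof.
move=> FM; split=> [|E FE u v uv E' _ /(_ E FE)|E ME FE u v].
- by apply: MFCE_finest => E FE u v; apply: (MFCE_ghost (FM E FE)).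
- by move=> EE'; exact: EE'.
- by move=> uv; exact: uv.
Qed.

(* Main.v *)
(* A son z = u x of x has its sons p z, q z over e z of the form (p x) u, (q x) u.
   Cancelling e u in a (e p) (e u) = a (e 1) (e u) gives e (p x) = a, and
   likewise for q. So p x and q x are sons of x over e x, and Is(x), being
   multiplicative, already identifies p z and q z. *)

Require Import Defs.
From Corelib Require Import Relation_Definitions.
From mathcomp Require Import all_boot all_algebra.

Set Implicit Arguments.
Unset Strict Implicit.
Unset Printing Implicit Defensive.

Import GRing.Theory.
Local Open Scope ring_scope.

Lemma ghost_unit_mul_idem (U : comPzSemiRingType) :
  supertropical U -> ghost_unit U * ghost_unit U = ghost_unit U.
Proof. by case=> eD _ _; rewrite {1}/ghost_unit mulrDl mul1r. Qed.

(** The ghosts form an ideal, so a ghost factor would make the product ghost. *)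
Lemma tangible_mull (U : comPzSemiRingType) (p q : U) :
  tangible (p * q) -> tangible p.
Proof. by move=> tpq [r pE]; apply: tpq; exists (r * q); rewrite pE mulrA. Qed.

Lemma tangible_mulr (U : comPzSemiRingType) (p q : U) :
  tangible (p * q) -> tangible q.
Proof. by rewrite mulrC; apply: tangible_mull. Qed.

Lemma son_refl (U : comPzSemiRingType) (x : U) : tangible x -> son x x.
Proof. by split=> //; exists 1; rewrite mul1r. Qed.

Theorem theorem7p18 (U : comPzSemiRingType) (hU : supertropical U)
    (x : U) (hx : tangible x) (a : U) (ha : a = ghost_unit U * x)
    (hcancel : forall b c d : U,
      ghost_of_tangible b -> ghost_of_tangible c -> ghost_of_tangible d ->
      a * b * d = a * c * d -> a * b = a * c) :
  forall u v : U, Is x u v <-> Sis x u v.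
Proof.
set e := ghost_unit U in ha *.
have ee : e * e = e by apply: ghost_unit_mul_idem.
have ae : a * e = a by rewrite ha mulrAC ee.
(* [1] divides the tangible [x]; this lets [e * 1] enter the cancellation below. *)
have t1 : tangible (1 : U) by move: hx; rewrite -{1}(mul1r x) => /tangible_mull.
have sonP u p : tangible (p * (u * x)) -> e * (p * (u * x)) = e * (u * x) ->
    son_over x (e * x) (p * x).
  move=> tpux epux.
  have tpx : tangible (p * x).
    by apply: (@tangible_mull _ _ u); rewrite -mulrA [x * u]mulrC.
  have tu := tangible_mull (tangible_mulr tpux).
  split; first by split=> //; exists p.
  (* Taken at [r = p] and [r = 1], this turns the equality of ghosts into the premise of
     [hcancel]. *)
  have aM r : a * (e * r) * (e * u) = e * (r * (u * x)).
    rewrite [a * (e * r)]mulrA ae mulrACA ae ha -mulrA; congr (_ * _).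
    by rewrite mulrC -mulrA.
  have : a * (e * p) = a * (e * 1).
    apply: (hcancel _ _ (e * u)).
    - by exists p => //; apply: tangible_mull tpx.
    - by exists 1.
    - by exists u.
    by rewrite !aM mul1r.
  by rewrite !mulrA ae mulr1 ha mulrAC.
have [ME _ _] := Is_finest x.
move=> u v; split=> [uv E _ EF | suv E mE xE].
  (* [x] is a son of itself, so [Is x] is one of the joined relations. *)
  by apply: (EF (Is x)) => //; exists x => //; apply: son_refl.
(* [E] bounds the join once it contains [Is z] for each son [z = w * x], hence once it identifies
   the sons of [z] over [e * z]. *)
apply: suv => // _ [z [[w ->] _] ->] s t; apply=> //.
move=> {}s {}t [[[p ->] ts] es] [[[q ->] tt] et].
have Epq := xE _ _ (sonP _ _ ts es) (sonP _ _ tt et).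
by have := MFCE_mul mE w Epq; rewrite -!mulrA ![x * w]mulrC.
Qed.
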